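(* Let $T_i:\mathcal{E}\to\mathcal{E}$ be continuous for every $i\in I$. Let $(X_k)$ be the random function iteration sequence $X_{k+1}=T_{\xi_k}X_k$ for some initial measure $X_0\sim\mu\in\mathscr{P}(\mathcal{E})$. Suppose that there is $M\ge 0$ such that $\mathbb{E}[\|X_k\|]\le M$ for all $k\in\mathbb{N}$. Then there exists an invariant probability measure for the Markov operator $\mathcal{P}$ associated with the transition kernel $p(x,A)=\mathbb{P}(T_\xi x\in A)$.
   Context: $\mathcal{E}$ is a Euclidean space (finite-dimensional real inner product space); $\mathscr{P}(\mathcal{E})$ is the set of Borel probability measures on $\mathcal{E}$. $(I,\mathcal{I})$ is a measurable space, $\xi$ is an $I$-valued random variable on a probability space $(\Omega,\mathcal{F},\mathbb{P})$, $(\xi_k)_{k\in\mathbb{N}}$ (with $0\in\mathbb{N}$) are i.i.d. with the same distribution as $\xi$, $X_0,\xi_0,\dots,\xi_k$ are independent for every $k$, and $(x,i)\mapsto T_ix$ is measurable on $\mathcal{E}\times I$. The Markov operator acts on measures by $(\mu\mathcal{P})(A)=\int p(x,A)\,\mu(dx)$; a probability measure $\pi$ is invariant if $\pi\mathcal{P}=\pi$. *)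

(* Defs.v *)
From HB Require Import structures.
From mathcomp Require Import all_boot all_order all_algebra finmap.
From mathcomp Require Import sesquilinear.
From mathcomp Require Import all_classical all_reals all_analysis.
From mathcomp Require Import giry.

Set Implicit Arguments.
Unset Strict Implicit.
Unset Printing Implicit Defensive.

Import Order.TTheory GRing.Theory Num.Theory.
Import numFieldNormedType.Exports.

Local Open Scope classical_set_scope.
Local Open Scope ring_scope.

HB.mixin Record NormedVector_isEuclidean (R : realType) E
    & NormedModule R E & Vector R E := {
  inner : {dot E for (@idfun R)} ;
  normr_inner : forall x : E, `|x| ^+ 2 = inner x x
}.

(* A finite-dimensional real normed space whose norm (hence, by the axioms of
   [normedModType], whose topology) is induced by an inner product. *)
#[short(type="euclideanType")]
HB.structure Definition Euclidean (R : realType) :=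
  {E of NormedModule R E & Vector R E & NormedVector_isEuclidean R E}.

(* [borel E] is convertible to [E]; the alias carries the Borel
   sigma-algebra. *)
Notation borel E := (g_sigma_algebraType (@open E)).

Section independence.
Context d (Omega : measurableType d) (R : realType) (P : probability Omega R).

(* Mutual independence: the product rule holds for every finite subfamily. *)
Definition mutually_independent (K : choiceType)
    (F : K -> set (set Omega)) : Prop :=
  forall (J : {fset K}) (A : K -> set Omega), (forall j, j \in J -> F j (A j)) ->
    P (\bigcap_(j in [set` J]) A j) = (\prod_(j <- J) P (A j))%E.

Definition iid_as d' (I : measurableType d')
    (xi : {RV P >-> I}) (xis : nat -> {RV P >-> I}) : Prop :=
  (forall k, measure_eq (distribution P (xis k)) (distribution P xi)) /\
  mutually_independent (fun k => g_sigma_algebra_preimage (xis k)).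

(* The variables [X, xis 0, ..., xis k] are mutually independent; [None]
   indexes [X]. *)
Definition independent_upto d1 (S : measurableType d1)
    d2 (I : measurableType d2) (X : {RV P >-> S}) (xis : nat -> {RV P >-> I})
    (k : nat) : Prop :=
  mutually_independent (fun o : option 'I_k.+1 =>
    if o is Some j then g_sigma_algebra_preimage (xis j)
    else g_sigma_algebra_preimage X).

End independence.

Section rfi.
Context (E I Omega : Type) (T : I -> E -> E).

(* Random function iteration: X_{k+1} = T_{xi_k} X_k. *)
Fixpoint rfi (X0 : Omega -> E) (xis : nat -> Omega -> I) (k : nat)
    (w : Omega) : E :=
  if k is k'.+1 then T (xis k' w) (rfi X0 xis k' w) else X0 w.

End rfi.

Section markov.
Local Open Scope ereal_scope.
Context d (S : measurableType d) (R : realType).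

Definition transition_kernel d1 (I : measurableType d1)
    d2 (Omega : measurableType d2) (P : probability Omega R)
    (T : I -> S -> S) (xi : {RV P >-> I}) (x : S) (A : set S) : \bar R :=
  P [set w | A (T (xi w) x)].

Definition markov_operator (p : S -> set S -> \bar R)
    (mu : probability S R) (A : set S) : \bar R :=
  \int[mu]_x p x A.

Definition invariant_measure (p : S -> set S -> \bar R)
    (pi : probability S R) : Prop :=
  forall A, measurable A -> markov_operator p pi A = pi A.

End markov.

(* Main.v *)
Require Import Defs.
From HB Require Import structures.
From mathcomp Require Import all_boot all_order all_algebra finmap.
From mathcomp Require Import sesquilinear.
From mathcomp Require Import all_classical all_reals all_analysis.
From mathcomp Require Import giry.
From mathcomp Require Import measurable_realfun.

Set Implicit Arguments.
Unset Strict Implicit.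
Unset Printing Implicit Defensive.

Import Order.TTheory GRing.Theory Num.Theory.
Import numFieldNormedType.Exports.

Local Open Scope classical_set_scope.
Local Open Scope ring_scope.

(** The existence of an invariant probability follows the method of Krylov and
    Bogolyubov: average the laws a_k of the iterates X_k, take a limit of the
    averages, and use that the Markov operator is Feller to see that the limit
    is fixed.

    The limit is taken without sequential compactness. A Banach limit L turns
    the sequence of laws into one set function lam(A) = L (k |-> a_k(A)), which
    is only finitely additive. Being shift-invariant, L makes lam invariant in
    the sense that L (k |-> (a_k P)(A)) = lam(A), because a_(k+1) = a_k P; this
    last identity ([chain_distributionS]) rests on the independence of X_k and
    xi_k, which holds because X_k is a function of X_0, xi_0, ..., xi_(k-1).

    The bound on E|X_k| enters through Markov's inequality: the complement of
    a large ball, which is compact since the dimension is finite, has small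
    lam-measure. This tightness is what makes the inner approximation
    beta(G) = sup_r lam {x | ball x r is contained in G} countably subadditive
    on open sets, and Caratheodory's construction then gives a Borel
    probability pi equal to beta on open sets ([ex_limit_measure]). So pi
    satisfies pi(G) <= lam(G) and lam(G eroded by r) <= pi(G) for G open.

    For invariance only inequalities on open sets are needed. If G is open then
    x |-> p(x, G) is lower semicontinuous ([transition_kernel_lsc]), that is,
    its strict superlevel sets are open, and comparing pi with lam on those
    sets gives (pi P)(G) <= L (k |-> (a_k P)(G)) = lam(G) through a layer-cake
    sum ([integral_le_blim]). Applied to slightly eroded open sets this improves
    to (pi P)(G) <= pi(G), and two Borel probabilities that are comparable on
    all open sets coincide ([eq_probability_le_open]). *)

(** * Banach limits *)

Lemma ultra_fmap (S S' : Type) (U : set_system S) (f : S -> S') :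
  UltraFilter U -> UltraFilter (f @ U).
Proof.
move=> UU; split=> [|G PG fUG]; first exact: fmap_proper_filter.
rewrite eqEsubset; split=> // A GA.
have [//|UnA] := in_ultra_setVsetC (f @^-1` A) UU.
have GnA : G (~` A) by exact: fUG.
by have [y []] := filter_ex (filterI GA GnA).
Qed.

Definition bounded_seq (R : realType) (u : nat -> R) :=
  exists C : R, forall n, `|u n| <= C.

(** All laws are confined to bounded sequences: outside of them an averaging
    operator may take arbitrary values. *)
Record banach_limit (R : realType) (L : (nat -> R) -> R) : Prop := {
  blim_le : forall u v, bounded_seq u -> bounded_seq v ->
    (forall n, u n <= v n) -> L u <= L v ;
  blimD : forall u v, bounded_seq u -> bounded_seq v ->
    L (fun n => u n + v n) = L u + L v ;
  blimZ : forall c u, bounded_seq u -> L (fun n => c * u n) = c * L u ;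
  blim_cst : forall c, L (fun=> c) = c ;
  blim_shift : forall u, bounded_seq u -> L (fun n => u n.+1) = L u }.

Section banach_limit_existence.
Context {R : realType}.
Implicit Types u v : nat -> R.

Definition cesaro u (n : nat) : R := n.+1%:R^-1 * \sum_(0 <= k < n.+1) u k.

Lemma cesaro_bound u (C : R) :
  (forall n, `|u n| <= C) -> forall n, `|cesaro u n| <= C.
Proof.
move=> uC n; rewrite /cesaro normrM normfV normr_nat mulrC ler_pdivrMr//.
rewrite (le_trans (ler_norm_sum _ _ _))// mulr_natr.
rewrite (le_trans (ler_sum _ (fun i _ => uC i)))//.
by rewrite big_mkord sumr_const card_ord.
Qed.

(** Limit of the Cesaro means along an ultrafilter finer than the filter of
    neighborhoods of infinity. Every bounded sequence converges along such an
    ultrafilter, and the Cesaro means of a bounded sequence and of its shift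
    differ by a null sequence, hence the invariance under the shift. *)
Lemma ex_banach_limit : exists L : (nat -> R) -> R, banach_limit L.
Proof.
have [U [UU UF]] := @ultraFilterLemma nat \oo _.
have PU : ProperFilter U by exact: ultra_proper.
have cvU u (C : R) : (forall n, `|u n| <= C) -> cvg (u @ U).
  move=> uC; have uU : UltraFilter (u @ U) by exact: ultra_fmap.
  have := @segment_compact R (- C) C.
  rewrite compact_ultra => /(_ _ uU)[|l [_ ul]]; last by apply/cvg_ex; exists l.
  by apply: nearW => n /=; rewrite in_itv/= -ler_norml.
have cvC u : bounded_seq u -> cvg (cesaro u @ U).
  by move=> [C uC]; apply: (cvU _ C); exact: cesaro_bound.
exists (fun u => lim (cesaro u @ U)); split.
- move=> u v bu bv uv; apply: ler_lim; [exact: cvC|exact: cvC|].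
  apply: nearW => n; rewrite /cesaro ler_wpM2l//.
  by apply: ler_sum => i _.
- move=> u v bu bv.
  rewrite -limD//; [|exact: cvC|exact: cvC].
  congr (lim (_ @ U)); apply/funext => n.
  by rewrite /cesaro/= big_split/= mulrDr.
- move=> c u bu.
  have -> : cesaro (fun n => c * u n) = (fun n => c * cesaro u n).
    by apply/funext => n; rewrite /cesaro/= -mulr_sumr mulrCA.
  by apply/cvg_lim => //; apply: cvgMr; exact: cvC.
- move=> c.
  have -> : cesaro (fun=> c) = fun=> c.
    apply/funext => n; rewrite /cesaro big_mkord sumr_const card_ord.
    by rewrite -[c *+ _]mulr_natl mulKf.
  exact: lim_cst.
- move=> u [C uC].
  have bu : bounded_seq u by exists C.
  suff d0 : (cesaro (fun n => u n.+1) \- cesaro u) @ U --> (0 : R).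
    apply/cvg_lim => //.
    have -> : cesaro (fun n => u n.+1) =
        (cesaro (fun n => u n.+1) \- cesaro u) \+ cesaro u.
      by apply/funext => n /=; rewrite subrK.
    rewrite -[X in _ --> X]add0r; apply: cvgD => //; exact: cvC.
  suff : (cesaro (fun n => u n.+1) \- cesaro u) @ \oo --> (0 : R).
    by move=> + A => /(_ A)/[apply]; exact: UF.
  have -> : cesaro (fun n => u n.+1) \- cesaro u =
      (fun n => n.+1%:R^-1 * (u n.+1 - u 0%N)).
    apply/funext => n /=; rewrite /cesaro -mulrBr; congr (_ * _).
    rewrite -[X in _ - X]/(\sum_(0 <= k < n.+1) u k).
    by rewrite -sumrB telescope_sumr.
  have bd n : `|u n.+1 - u 0%N| <= C + C.
    by rewrite (le_trans (ler_normB _ _))// lerD.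
  apply: norm_cvg0.
  apply: (@squeeze_cvgr _ _ _ _ (fun=> 0) (fun n => n.+1%:R^-1 * (C + C))).
  + apply: nearW => n /=; rewrite normr_ge0 normrM normfV normr_nat/=.
    by rewrite ler_wpM2l.
  + exact: cvg_cst.
  + rewrite -[X in _ --> X](mul0r (C + C)); apply: cvgMl.
    exact: cvg_harmonic.
Qed.

End banach_limit_existence.

(** * From a tight content to a measure *)

Section erosion.
Context {R : realType} {E : normedModType R}.
Implicit Types (A B G : set E) (r s : R) (n : nat).

(** The complement of the open r-thickening of the complement of [G], hence
    closed whatever [G] is. *)
Definition erosion r G : set E := [set x | ball x r `<=` G].

Lemma erosionS r A B : A `<=` B -> erosion r A `<=` erosion r B.
Proof. by move=> AB x xA; exact: subset_trans AB. Qed.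

Lemma le_erosion r s G : s <= r -> erosion r G `<=` erosion s G.
Proof. by move=> sr x xG y xy; apply: xG; exact: le_ball xy. Qed.

Lemma erosion_sub r G : 0 < r -> erosion r G `<=` G.
Proof. by move=> r0 x; apply; exact: ballxx. Qed.

Lemma closed_erosion r G : closed (erosion r G).
Proof.
have -> : erosion r G = ~` \bigcup_(y in ~` G) ball y r.
  apply/seteqP; split=> [x xG [y nGy yx]|x nx y xy].
    by apply: nGy; apply: xG; exact: ball_sym.
  by apply: contrapT => nGy; apply: nx; exists y => //; exact: ball_sym.
rewrite closedC; by apply: bigcup_open => y _; exact: ball_open.
Qed.

Lemma measurable_erosion r G : measurable (erosion r G : set (borel E)).
Proof.
rewrite -[erosion r G]setCK; apply: measurableC.
by apply: sub_sigma_algebra; apply: closed_openC; exact: closed_erosion.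
Qed.

(** The erosions exhaust an open set locally uniformly, which is the form that
    compactness can exploit. *)
Lemma near_erosion G x : open G -> G x ->
  \forall y \near x & n \near \oo, erosion n.+1%:R^-1 G y.
Proof.
move=> oG Gx.
have /nbhs_ballP[e /= e0 eG] := open_nbhs_nbhs (conj oG Gx).
have e20 : 0 < e / 2 by rewrite divr_gt0.
near=> y n => /= z yz.
apply: eG; rewrite (splitr e); apply: (@ball_triangle _ _ y).
  by near: y; exact: (nbhsx_ballx _ _ e20).
apply: le_ball yz; apply: ltW.
near: n; exact: near_infty_natSinv_lt (PosNum e20).
Unshelve. all: by end_near. Qed.

End erosion.

Section limit_measure.
Context {R : realType} {E : normedModType R}.
Implicit Types (A B G : set E) (n : nat).
Local Notation mborel A := (measurable (A : set (borel E))).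

(** A finitely additive probability on the Borel sets whose mass cannot escape
    to infinity. *)
Record tight_content (lam : set E -> R) : Prop := {
  tcontent_ge0 : forall A, measurable (A : set (borel E)) -> 0 <= lam A ;
  tcontentU : forall A B, measurable (A : set (borel E)) ->
    measurable (B : set (borel E)) -> A `&` B = set0 ->
    lam (A `|` B) = lam A + lam B ;
  tcontentT : lam [set: E] = 1 ;
  tcontent_tight : forall e, 0 < e ->
    exists2 K : set E, compact K & lam (~` K) <= e }.

Variable lam : set E -> R.
Hypothesis tlam : tight_content lam.

Let lam0 : lam set0 = 0.
Proof.
have m0 := @measurable0 _ (borel E).
have := tcontentU tlam m0 m0 (setI0 _); rewrite setU0 => /eqP.
by rewrite -subr_eq0 opprD addrA subrr sub0r oppr_eq0 => /eqP.
Qed.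

Lemma le_tcontent A B : measurable (A : set (borel E)) ->
  measurable (B : set (borel E)) -> A `<=` B -> lam A <= lam B.
Proof.
move=> mA mB AB; rewrite -(setDUK AB) (tcontentU tlam)//.
- by rewrite lerDl (tcontent_ge0 tlam)//; exact: (@measurableD _ (borel E)).
- exact: (@measurableD _ (borel E)).
- by rewrite setDE setICA setICr setI0.
Qed.

Lemma tcontentU_le A B : mborel A -> mborel B ->
  lam (A `|` B) <= lam A + lam B.
Proof.
move=> mA mB; rewrite -(setDUK (@subsetUl _ A B)).
have mD : mborel ((A `|` B) `\` A).
  by apply: measurableD => //; exact: measurableU.
rewrite (tcontentU tlam)//; last by rewrite setDE setICA setICr setI0.
by rewrite lerD2l le_tcontent// => x [[]].
Qed.

Lemma tcontent_bigsetU_le (B : nat -> set E) n : (forall i, mborel (B i)) ->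
  lam (\big[setU/set0]_(i < n) B i) <= \sum_(i < n) lam (B i).
Proof.
move=> mB; elim: n => [|n IH]; first by rewrite !big_ord0 lam0.
rewrite !big_ord_recr/= (le_trans (tcontentU_le _ _))//.
  exact: bigsetU_measurable.
by rewrite lerD2r.
Qed.

Lemma tcontent_le1 A : mborel A -> lam A <= 1.
Proof. by move=> mA; rewrite -(tcontentT tlam) le_tcontent. Qed.

(** Erosions replace the compact subsets of the classical inner approximation:
    they are monotone in both arguments, so no compact set ever has to be split
    along an open cover. *)
Definition inner_content G : \bar R :=
  ereal_sup (range (fun n => (lam (erosion n.+1%:R^-1 G))%:E)).

Lemma inner_content_ge n G :
  ((lam (erosion n.+1%:R^-1 G))%:E <= inner_content G)%E.
Proof. by apply: ereal_sup_ubound; exists n. Qed.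

Lemma inner_content_ge0 G : (0 <= inner_content G)%E.
Proof.
apply: le_trans (inner_content_ge 0 G); rewrite lee_fin (tcontent_ge0 tlam)//.
exact: measurable_erosion.
Qed.

Lemma inner_content_le1 G : (inner_content G <= 1)%E.
Proof.
apply: ge_ereal_sup => _ [n _ <-]; rewrite lee_fin tcontent_le1//.
exact: measurable_erosion.
Qed.

Lemma inner_content_le A G : mborel A ->
  (forall n, erosion n.+1%:R^-1 G `<=` A) -> (inner_content G <= (lam A)%:E)%E.
Proof.
move=> mA GA; apply: ge_ereal_sup => _ [n _ <-]; rewrite lee_fin.
by apply: le_tcontent => //; exact: measurable_erosion.
Qed.

Lemma le_inner_content A B : A `<=` B -> (inner_content A <= inner_content B)%E.
Proof.
move=> AB; apply: ge_ereal_sup => _ [n _ <-].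
apply: le_trans (inner_content_ge n B); rewrite lee_fin.
by apply: le_tcontent; [exact: measurable_erosion..|exact: erosionS].
Qed.

(** By tightness only the part of an erosion of the union lying in a compact set
    [K] matters, and by [near_erosion] finitely many eroded [G n], all eroded by
    the same amount, cover that part. Finite subadditivity of [lam] concludes. *)
Lemma inner_content_sigma_subadditive (G : nat -> set E) :
  (forall n, open (G n)) ->
  (inner_content (\bigcup_n G n) <= \sum_(n <oo) inner_content (G n))%E.
Proof.
move=> oG; apply: ge_ereal_sup => _ [m _ <-]; apply/lee_addgt0Pr => e e0.
have [K cK lamK] := tcontent_tight tlam e0.
set F := erosion _ _.
have mF : mborel F by exact: measurable_erosion.
have mK : mborel K.
  rewrite -[K]setCK; apply: measurableC; apply: sub_sigma_algebra.
  by apply: closed_openC; apply: compact_closed => //; exact: norm_hausdorff.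
have cKF : compact (K `&` F).
  by apply: compact_closedI => //; exact: closed_erosion.
(* One rank N serves both as erosion depth and as number of sets. *)
have [N _ KFN] : \forall N \near \oo, K `&` F `<=`
    (fun y => exists2 n, (n < N)%N & erosion N.+1%:R^-1 (G n) y).
  apply: ((compact_near_coveringP _).1 cKF) => x [_ Fx].
  have [n _ Gx] : (\bigcup_n G n) x.
    by apply: (erosion_sub _ Fx); rewrite invr_gt0.
  apply: filter_app (near_erosion (oG n) Gx).
  exists (setT, [set N | (n < N)%N]).
    by split; [exact: filterT|exact: nbhs_infty_gt].
  by move=> [y N] [_ /= nN] Gy; exists n.
have {}KFN := KFN N (leqnn N).
have lamF : lam F <= \sum_(n < N) lam (erosion N.+1%:R^-1 (G n)) + e.
  rewrite -(setUIDK F K) (le_trans (tcontentU_le _ _))//.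
  - exact: measurableI.
  - exact: measurableD.
  apply: lerD; last first.
    apply: le_trans lamK.
    by apply: le_tcontent; [exact: measurableD|exact: measurableC|move=> x []].
  have mGN n : mborel (erosion N.+1%:R^-1 (G n)) by exact: measurable_erosion.
  apply: le_trans (tcontent_bigsetU_le N mGN).
  apply: le_tcontent; first exact: measurableI.
    by apply: bigsetU_measurable => i _; exact: mGN.
  move=> x [Fx Kx]; have [n nN Gx] := KFN x (conj Kx Fx).
  rewrite -(bigcup_mkord N (fun n => erosion N.+1%:R^-1 (G n))).
  by exists n.
have := lamF; rewrite -lee_fin => /le_trans; apply.
rewrite EFinD leeD2r// -sumEFin.
apply: (@le_trans _ _ (\sum_(n < N) inner_content (G n))%E).
  by apply: lee_sum => i _; exact: inner_content_ge.
rewrite -(big_mkord xpredT (fun n => inner_content (G n))).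
by apply: nneseries_lim_ge => n _ _; exact: inner_content_ge0.
Qed.

Definition outer_content A : \bar R :=
  ereal_inf [set inner_content G | G in [set G | open G /\ A `<=` G]].

Lemma outer_content_le A G : open G -> A `<=` G ->
  (outer_content A <= inner_content G)%E.
Proof. by move=> oG AG; apply: ereal_inf_lbound; exists G. Qed.

Lemma outer_content_open G : open G -> outer_content G = inner_content G.
Proof.
move=> oG; apply/eqP; rewrite eq_le outer_content_le//=.
by apply: le_ereal_inf_tmp => _ [H [oH GH] <-]; exact: le_inner_content.
Qed.

Lemma outer_content_ge0 A : (0 <= outer_content A)%E.
Proof. by apply: le_ereal_inf_tmp => _ [G _ <-]; exact: inner_content_ge0. Qed.

Lemma outer_content_fin_num A : outer_content A \is a fin_num.
Proof.
rewrite ge0_fin_numE ?outer_content_ge0//.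
rewrite (le_lt_trans (outer_content_le openT (@subsetT _ A)))//.
by rewrite (le_lt_trans (inner_content_le1 _))// ltry.
Qed.

Lemma outer_content0 : outer_content set0 = 0%E.
Proof.
apply/eqP; rewrite eq_le outer_content_ge0 andbT.
rewrite (le_trans (outer_content_le open0 (@subset_refl _ _)))//.
rewrite -[X in (_ <= X)%E]/(0%:E) -lam0.
apply: inner_content_le; first exact: measurable0.
by move=> n; apply: erosion_sub; rewrite invr_gt0.
Qed.

Lemma le_outer_content : {homo outer_content : A B / A `<=` B >-> (A <= B)%E}.
Proof.
move=> A B AB; apply: le_ereal_inf_tmp => _ [G [oG BG] <-].
by apply: outer_content_le => //; exact: subset_trans BG.
Qed.

Lemma outer_content_sigma_subadditive : sigma_subadditive outer_content.
Proof.
move=> A; apply/lee_addgt0Pr => e e0.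
have A_ge0 n : (0 <= outer_content (A n))%E by exact: outer_content_ge0.
apply: le_trans (epsilon_trick xpredT A_ge0 (ltW e0)).
have /choice[G PG] n : exists G, [/\ open G, A n `<=` G &
    (inner_content G <= outer_content (A n) + (e / (2 ^ n.+1)%:R)%:E)%E].
  have en0 : 0 < e / (2 ^ n.+1)%:R :> R.
    by rewrite divr_gt0// ltr0n expn_gt0.
  have [_ [G [oG AG] <-] /ltW Ge] :=
    lb_ereal_inf_adherent en0 (outer_content_fin_num (A n)).
  by exists G.
apply: (@le_trans _ _ (inner_content (\bigcup_n G n))).
  apply: outer_content_le; first by apply: bigcup_open => n _; have [] := PG n.
  by apply: subset_bigcup => n _; have [] := PG n.
have oG n : open (G n) by have [] := PG n.
apply: (le_trans (inner_content_sigma_subadditive oG)).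
apply: lee_nneseries => n _; first by move=> _; exact: inner_content_ge0.
by have [] := PG n.
Qed.

(** Once a closed erosion [F] of [H `&` G] is removed from [H], an erosion of
    what remains is disjoint from [F] while both lie in a common erosion of [H];
    the additivity of [lam] on these two sets gives the splitting. *)
Lemma open_caratheodory G : open G -> forall X,
  (outer_content (X `&` G) + outer_content (X `&` ~` G) <= outer_content X)%E.
Proof.
move=> oG X; apply: le_ereal_inf_tmp => _ [H [oH XH] <-].
have oHG : open (H `&` G) by exact: openI.
apply: (@le_trans _ _ (inner_content (H `&` G) + outer_content (X `&` ~` G))%E).
  by rewrite leeD2r// outer_content_le//; exact: setSI.
rewrite -leeBrDr ?outer_content_fin_num//.
apply: ge_ereal_sup => _ [m _ <-]; set F := erosion _ _.
rewrite leeBrDr ?outer_content_fin_num// addeC -leeBrDr//.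
have FHG : F `<=` H `&` G by apply: erosion_sub; rewrite invr_gt0.
have mF : mborel F by exact: measurable_erosion.
apply: (@le_trans _ _ (inner_content (H `\` F))).
  apply: outer_content_le.
    rewrite setDE; apply: openI => //.
    by apply: closed_openC; exact: closed_erosion.
  by move=> x [Xx nGx]; split; [exact: XH|move=> /FHG[]].
apply: ge_ereal_sup => _ [j _ <-]; set F' := erosion _ _.
have mF' : mborel F' by exact: measurable_erosion.
rewrite leeBrDr// -EFinD -(tcontentU tlam)//; last first.
  apply/seteqP; split=> // x [F'x Fx].
  have j0 : 0 < j.+1%:R^-1 :> R by rewrite invr_gt0.
  by have [] := erosion_sub j0 F'x.
apply: le_trans (inner_content_ge (maxn m j) H); rewrite lee_fin.
apply: le_tcontent; [exact: measurableU|exact: measurable_erosion|].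
have le_max (k : nat) : (k <= maxn m j)%N ->
    (maxn m j).+1%:R^-1 <= k.+1%:R^-1 :> R.
  by move=> kmj; rewrite lef_pV2 ?posrE// ler_nat.
rewrite subUset; split.
  apply: subset_trans (le_erosion (le_max j (leq_maxr _ _))).
  by apply: erosionS => x [].
apply: subset_trans (le_erosion (le_max m (leq_maxl _ _))).
by apply: erosionS => x [].
Qed.

(** Open sets being Caratheodory measurable, so are all Borel sets. No mass is
    lost because the whole space is its own erosion. *)
Lemma ex_limit_measure : exists pi : probability (borel E) R,
  forall G, open G -> pi G = inner_content G.
Proof.
pose gam : {outer_measure set E -> \bar R} := HB.pack outer_content
  (isOuterMeasure.Build R E outer_content outer_content0 outer_content_ge0
    le_outer_content outer_content_sigma_subadditive).
have sub_cara : @measurable _ (borel E) `<=` gam.-cara.-measurable.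
  apply: smallest_sub; first exact: sigma_algebra_measurable.
  by move=> G oG; apply: le_caratheodory_measurable; exact: open_caratheodory.
have add : semi_sigma_additive (outer_content : set (borel E) -> \bar R).
  move=> F mF tF mUF.
  exact: (@caratheodory_measure_sigma_additive R E gam F
    (fun n => sub_cara _ (mF n)) tF (sub_cara _ mUF)).
pose m : set (borel E) -> \bar R := outer_content.
pose pim : {measure set (borel E) -> \bar R} := HB.pack m
  (isMeasure.Build _ _ _ m outer_content0 outer_content_ge0 add).
have pT : pim setT = 1%E.
  rewrite /pim/= /m outer_content_open; last exact: openT.
  apply/eqP; rewrite eq_le inner_content_le1/=.
  apply: le_trans (inner_content_ge 0 _); rewrite lee_fin -(tcontentT tlam).
  by apply: le_tcontent => //; exact: measurable_erosion.
pose pip : probability (borel E) R := HB.pack (Measure.sort pim)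
  (Measure_isProbability.Build _ _ _ pim pT).
by exists pip => G oG; exact: outer_content_open.
Qed.

End limit_measure.
(** * Comparison of integrals by layers *)

Lemma fine_probability_bound d (S : measurableType d) (R : realType)
    (m : probability S R) (A : set S) : measurable A -> 0 <= fine (m A) <= 1.
Proof.
move=> mA; rewrite fine_ge0//= -lee_fin fineK ?probability_le1//.
exact: fin_num_measure.
Qed.

Lemma blim_sum (R : realType) (L : (nat -> R) -> R) (u : nat -> nat -> R) N :
  banach_limit L -> (forall j, bounded_seq (u j)) ->
  L (fun k => \sum_(j < N) u j k) = \sum_(j < N) L (u j).
Proof.
move=> HL bu; elim: N => [|N IH].
  rewrite big_ord0 -[RHS](blim_cst HL 0).
  by congr L; apply/funext => k; rewrite big_ord0.
rewrite big_ord_recr/= -IH -(blimD HL)//.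
  by congr L; apply/funext => k; rewrite big_ord_recr.
elim: N {IH} => [|N [C uC]]; first by exists 0 => n; rewrite big_ord0 normr0.
have [D uD] := bu N; exists (C + D) => n; rewrite big_ord_recr/=.
by rewrite (le_trans (ler_normD _ _))// lerD.
Qed.

(** For [y > 0] the sum is the ceiling of [y] minus one. *)
Lemma count_below (R : realType) N (y : R) : 0 <= y -> y <= N%:R ->
  \sum_(j < N) (j.+1%:R < y)%R%:R <= y /\
  y <= \sum_(j < N) (j.+1%:R < y)%R%:R + 1.
Proof.
elim: N => [|N IH] y0 yN.
  have /eqP -> : y == 0 by rewrite eq_le y0 yN.
  by rewrite big_ord0 add0r.
rewrite big_ord_recr/= [N.+1%:R < y]ltNge yN/= addr0.
have [yN'|Ny] := leP y N%:R; first exact: IH.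
have -> : \sum_(j < N) (j.+1%:R < y)%R%:R = N%:R :> R.
  rewrite -[in RHS](card_ord N) -sum1_card natr_sum; apply: eq_bigr => j _.
  by rewrite (le_lt_trans _ Ny)// ler_nat.
by split; [exact: ltW|rewrite natr1].
Qed.

Section layer_cake.
Context d (S : measurableType d) (R : realType).
Variable f : S -> R.
Hypotheses (mf : measurable_fun setT f) (f0 : forall x, 0 <= f x)
  (f1 : forall x, f x <= 1).

Definition layer (N j : nat) : set S := [set x | j.+1%:R / N.+1%:R < f x].

Lemma measurable_layer N j : measurable (layer N j).
Proof.
rewrite (_ : layer N j = f @^-1` `]j.+1%:R / N.+1%:R, +oo[).
  by rewrite -[X in measurable X]setTI; exact: mf.
by apply/seteqP; split=> x /=; rewrite in_itv/= andbT.
Qed.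

Lemma integral01 (m : probability S R) :
  (\int[m]_x (f x)%:E)%E \is a fin_num /\ 0 <= fine (\int[m]_x (f x)%:E) <= 1.
Proof.
have i0 : (0 <= \int[m]_x (f x)%:E)%E.
  by apply: integral_ge0 => x _; rewrite lee_fin.
have i1 : (\int[m]_x (f x)%:E <= 1)%E.
  rewrite -(probability_setT m) -[X in (_ <= X)%E]mul1e.
  rewrite -(integral_cst m measurableT 1).
  apply: ge0_le_integral => //.
  - by move=> x _; rewrite lee_fin.
  - exact/measurable_EFinP.
  - by move=> x _; rewrite lee_fin.
have fn : (\int[m]_x (f x)%:E)%E \is a fin_num.
  by rewrite ge0_fin_numE// (le_lt_trans i1)// ltry.
by split=> //; rewrite -!lee_fin fineK// i0.
Qed.

Definition layer_sum (m : set S -> \bar R) N : R :=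
  N.+1%:R^-1 * \sum_(j < N.+1) fine (m (layer N j)).

(** [layer_sum m N] is the integral of the step function that rounds each
    positive value of [f] down to the largest strictly smaller multiple of
    [1 / N.+1], so it misses the integral of [f] by at most one step. *)
Lemma layer_cake_approx (m : probability S R) N :
  layer_sum m N <= fine (\int[m]_x (f x)%:E) <= layer_sum m N + N.+1%:R^-1.
Proof.
set s := layer_sum m N.
pose g x : R := N.+1%:R^-1 * \sum_(j < N.+1) \1_(layer N j) x.
have g0 x : 0 <= g x by rewrite mulr_ge0// sumr_ge0.
have mI j : measurable_fun setT (\1_(layer N j) : S -> R).
  by apply: measurable_indic; exact: measurable_layer.
have mg : measurable_fun setT g.
  apply: measurable_funM => //.
  by apply: measurable_sum => j; exact: mI.
have ig : (\int[m]_x (g x)%:E = s%:E)%E.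
  rewrite /g; under eq_integral do rewrite EFinM -sumEFin.
  rewrite ge0_integralZl//; last 2 first.
  - by apply: emeasurable_sum => j; exact/measurable_EFinP.
  - by move=> x _; apply: sume_ge0 => j _; rewrite lee_fin.
  rewrite ge0_integral_sum//; last by move=> j; exact/measurable_EFinP.
  rewrite /s /layer_sum EFinM -sumEFin; congr (_ * _)%E; apply: eq_bigr => j _.
  rewrite integral_indic//; last exact: measurable_layer.
  by rewrite setIT fineK// fin_num_measure//; exact: measurable_layer.
have fg x : g x <= f x /\ f x <= g x + N.+1%:R^-1.
  have N0 : 0 < N.+1%:R :> R by rewrite ltr0n.
  have [||lo hi] := @count_below R N.+1 (N.+1%:R * f x).
  - by rewrite mulr_ge0.
  - by rewrite -[leRHS]mulr1 ler_wpM2l.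
  have gE : \sum_(j < N.+1) (j.+1%:R < N.+1%:R * f x)%R%:R = N.+1%:R * g x.
    rewrite /g mulVKf//; apply: eq_bigr => j _.
    rewrite indicE; congr ((nat_of_bool _)%:R); apply/esym.
    by apply/idP/idP; rewrite inE /layer/= ltr_pdivrMr// mulrC.
  rewrite gE in lo hi.
  split; first by rewrite -(ler_pM2l N0).
  by rewrite -(ler_pM2l N0) mulrDr mulfV.
have [fn /andP[_ _]] := integral01 m.
rewrite -!lee_fin fineK// -ig; apply/andP; split.
  apply: ge0_le_integral => //.
  - by move=> x _; rewrite lee_fin.
  - exact/measurable_EFinP.
  - exact/measurable_EFinP.
  - by move=> x _; rewrite lee_fin; have [] := fg x.
rewrite EFinD -ig.
have -> : (N.+1%:R^-1%:E = \int[m]_x (cst N.+1%:R^-1%:E x))%E.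
  have := integral_cst m measurableT (N.+1%:R^-1%:E : \bar R).
  by rewrite [X in (_ * X)%E](probability_setT m) mule1.
rewrite -ge0_integralD//.
- apply: ge0_le_integral => //.
  + by move=> x _; rewrite lee_fin.
  + exact/measurable_EFinP.
  + by apply: emeasurable_funD => //; exact/measurable_EFinP.
  + by move=> x _; rewrite -EFinD lee_fin; have [] := fg x.
- by move=> x _; rewrite lee_fin.
- exact/measurable_EFinP.
- by move=> x _; rewrite lee_fin.
Qed.

(** A lower semicontinuous [f] has open strict superlevel sets, so this is half
    of the portmanteau theorem, for a limit measure dominated by the averages on
    open sets. The layer-cake sums have finitely many terms, so they commute
    with [L], which need not be countably additive. *)
Lemma integral_le_blim (L : (nat -> R) -> R) (a : nat -> probability S R)
    (p : probability S R) : banach_limit L ->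
  (forall t : R, (p [set x | (t < f x)%R] <=
     (L (fun k => fine (a k [set x | (t < f x)%R])))%:E)%E) ->
  fine (\int[p]_x (f x)%:E) <= L (fun k => fine (\int[a k]_x (f x)%:E)).
Proof.
move=> HL pL.
have b1 (m : probability S R) A : measurable A -> `|fine (m A)| <= 1.
  by move=> mA; have /andP[? ?] := fine_probability_bound m mA; rewrite ger0_norm.
apply/ler_addgt0Pr => e e0.
have [N Ne] : exists N, N.+1%:R^-1 < e.
  by have [N _ /(_ N (leqnn N))] := near_infty_natSinv_lt (PosNum e0); exists N.
have /andP[_ pN] := layer_cake_approx p N.
apply: le_trans pN _; apply: lerD; last exact: ltW.
have bl j : bounded_seq (fun k => fine (a k (layer N j))).
  by exists 1 => k; apply: b1; exact: measurable_layer.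
have bs : bounded_seq (fun k => \sum_(j < N.+1) fine (a k (layer N j))).
  exists N.+1%:R => k; rewrite (le_trans (ler_norm_sum _ _ _))//.
  rewrite -[in leRHS](card_ord N.+1) -sum1_card natr_sum.
  by apply: ler_sum => j _; apply: b1; exact: measurable_layer.
apply: (@le_trans _ _ (L (fun k => layer_sum (a k) N))).
  rewrite /layer_sum (blimZ HL)//.
  rewrite (@blim_sum _ _ (fun j k => fine (a k (layer N j))))//.
  rewrite ler_wpM2l//; apply: ler_sum => j _.
  rewrite -lee_fin fineK; last by apply: fin_num_measure; exact: measurable_layer.
  exact: pL.
apply: (blim_le HL).
- have [C bC] := bs; exists (N.+1%:R^-1 * C) => k.
  by rewrite normrM ger0_norm// ler_wpM2l.
- exists 1 => k; have [_ /andP[i0 i1]] := integral01 (a k).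
  by rewrite ger0_norm.
- by move=> k; have /andP[] := layer_cake_approx (a k) N.
Qed.

End layer_cake.

(** * The Markov operator of a random function *)

Section markov_step.
Context {R : realType} {E : normedModType R}.
Context (dI : measure_display) (I : measurableType dI).
Context (dO : measure_display) (Omega : measurableType dO).
Variables (P : probability Omega R) (T : I -> E -> E) (xi : {RV P >-> I}).
Hypothesis T_meas : measurable_fun [set: borel E * I]
  (fun z : borel E * I => T z.2 z.1 : borel E).
Local Open Scope ereal_scope.

Let p := transition_kernel (T : I -> borel E -> borel E) xi.

Definition noisy_step (z : borel E * Omega) : borel E := T (xi z.2) z.1.

Lemma measurable_noisy_step : measurable_fun setT noisy_step.
Proof.
have mpair : measurable_fun setT (fun z : borel E * Omega => (z.1, xi z.2)).
  by apply: measurable_fun_pair => //; apply: measurableT_comp.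
exact: (measurableT_comp T_meas mpair).
Qed.

Lemma transition_kernelE x A : p x A = P (xsection (noisy_step @^-1` A) x).
Proof.
by congr (P _); apply/seteqP; split=> w; rewrite /xsection/= inE.
Qed.

Lemma measurable_noisy_step_preimage A : measurable A ->
  measurable (noisy_step @^-1` A).
Proof.
move=> mA; rewrite -[X in measurable X]setTI.
exact: measurable_noisy_step.
Qed.

Lemma measurable_transition_set (x : borel E) (A : set (borel E)) :
  measurable A ->
  measurable [set w | A (T (xi w) x)].
Proof.
move=> mA; have := measurable_xsection x (measurable_noisy_step_preimage mA).
by congr measurable; apply/seteqP; split=> w; rewrite /xsection/= inE.
Qed.

Lemma measurable_transition_kernel A : measurable A ->
  measurable_fun setT (p ^~ A).
Proof.
move=> mA; rewrite (_ : p ^~ A = P \o xsection (noisy_step @^-1` A)).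
  by apply: measurable_fun_xsection; exact: measurable_noisy_step_preimage.
by apply/funext => x; rewrite transition_kernelE.
Qed.

Lemma transition_kernel_ge0 x A : 0 <= p x A.
Proof. exact: measure_ge0. Qed.

Lemma transition_kernel_le1 x A : measurable A -> p x A <= 1.
Proof. by move=> mA; apply: probability_le1; exact: measurable_transition_set. Qed.

Lemma transition_kernel_fin_num x A : measurable A -> p x A \is a fin_num.
Proof. by move=> mA; apply: fin_num_measure; exact: measurable_transition_set. Qed.

(** The image of [m] under the Markov operator is the law of [T (xi w) x] when
    [(x, w)] has law [m \x P], which makes it a probability measure. *)
Lemma ex_markov_step (m : probability (borel E) R) :
  exists m' : probability (borel E) R,
    forall A, measurable A -> m' A = markov_operator p m A.
Proof.
have mP1 : (m \x P) setT = 1.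
  rewrite -setXTT product_measure1E// -[RHS]mule1.
  by congr (_ * _); exact: probability_setT.
pose mP : probability (borel E * Omega)%type R := HB.pack (m \x P)
  (Measure_isProbability.Build _ _ _ (m \x P) mP1).
pose F : {mfun (borel E * Omega)%type >-> borel E} := HB.pack noisy_step
  (isMeasurableFun.Build _ _ _ _ noisy_step measurable_noisy_step).
exists (distribution mP F) => A mA.
by apply: eq_integral => x _; rewrite transition_kernelE.
Qed.

Hypothesis T_cont : forall i, continuous (T i).

(** For [G] open, [T (xi w) x] in [G] forces [T (xi w) y_n] in [G] for all large
    [n] whenever [y_n] tends to [x]; continuity from below of [P] on the events
    that this holds from rank [m] on then bounds [p x G] by any bound on the
    [p (y_n) G]. Sequences are used so that these events are measurable. *)
Lemma transition_kernel_lsc (G : set E) (t : R) : open G ->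
  open [set x : E | (t < fine (p x G))%R].
Proof.
move=> oG; have mG : measurable (G : set (borel E)) by exact: sub_sigma_algebra.
rewrite openE => x /= tx; rewrite /interior; apply: contrapT => nx.
have /choice[y Py] n : exists y, ball x (n.+1%:R^-1)%R y /\ (fine (p y G) <= t)%R.
  apply: contrapT => /forallNP Hn; apply: nx.
  apply/nbhs_ballP; exists (n.+1%:R^-1)%R; first by rewrite /= invr_gt0.
  move=> y xy /=; rewrite ltNge; apply/negP => yt; exact: (Hn y).
have yx : y @ \oo --> x.
  apply/cvg_ballP => e e0; near=> n.
  apply: le_ball (Py n).1; apply: ltW.
  near: n; exact: (near_infty_natSinv_lt (PosNum e0)).
pose V n := [set w | G (T (xi w) (y n))].
pose B m := \bigcap_(n >= m) V n.
have mV n : measurable (V n) by exact: measurable_transition_set.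
have mB m : measurable (B m) by apply: bigcap_measurableType => n _; exact: mV.
have ndB : nondecreasing_seq B.
  move=> m n mn; apply/subsetPset => w Bw k /= nk.
  by apply: Bw => /=; exact: leq_trans nk.
have VB : [set w | G (T (xi w) x)] `<=` \bigcup_m B m.
  move=> w /= Gw.
  have Tyx : T (xi w) (y n) @[n --> \oo] --> T (xi w) x.
    by apply: continuous_cvg; [exact: T_cont|exact: yx].
  have [m _ mG'] := Tyx _ (open_nbhs_nbhs (conj oG Gw)).
  by exists m => // n /= mn; exact: mG'.
have PB m : P (B m) <= t%:E.
  apply: (@le_trans _ _ (P (V m))).
    by rewrite le_measure ?inE// => w; apply => /=.
  have := (Py m).2; rewrite -lee_fin fineK//.
  exact: transition_kernel_fin_num.
have : p x G <= t%:E.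
  apply: (@le_trans _ _ (P (\bigcup_m B m))).
    rewrite le_measure ?inE//; first exact: measurable_transition_set.
    exact: bigcupT_measurable.
  have cvB := nondecreasing_cvg_mu (mu := P) mB (bigcupT_measurable _ mB) ndB.
  rewrite -(cvg_lim _ cvB)//; apply: lime_le.
    by apply/cvg_ex; eexists; exact: cvB.
  exact: nearW.
rewrite -(fineK (transition_kernel_fin_num x mG)) lee_fin => /(lt_le_trans tx).
by rewrite ltxx.
Unshelve. all: by end_near. Qed.

End markov_step.

(** * The law of the iterates *)

Section chain_law.
Context {R : realType} d (S : measurableType d).
Context (dI : measure_display) (I : measurableType dI).
Context (dO : measure_display) (Omega : measurableType dO).
Variables (P : probability Omega R) (T : I -> S -> S).
Hypothesis T_meas : measurable_fun [set: S * I] (fun z => T z.2 z.1).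
Variables (X0 : {RV P >-> S}) (xis : nat -> {RV P >-> I}).
Hypothesis X0_indep : forall k, independent_upto X0 xis k.
Local Open Scope ereal_scope.

(** The events [history k] form a pi-system generating the sigma-algebra of
    [X0, xis 0, ..., xis k.-1]. Indexing [B] by [nat] rather than by ['I_k] makes
    the systems comparable for different [k]. *)
Definition history_event k (A : set S) (B : nat -> set I) : set Omega :=
  X0 @^-1` A `&` \bigcap_(j in `I_k) xis j @^-1` B j.

Definition history k : set (set Omega) := [set C | exists A B,
  [/\ measurable A, forall j, measurable (B j) & C = history_event k A B]].

Lemma history_measurable k : history k `<=` measurable.
Proof.
move=> _ [A [B [mA mB ->]]]; apply: measurableI; first exact: measurable_funPTI.
by apply: bigcap_measurableType => j _; exact: measurable_funPTI.
Qed.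

Lemma history_setI k : setI_closed (history k).
Proof.
move=> _ _ [A [B [mA mB ->]]] [A' [B' [mA' mB' ->]]].
exists (A `&` A'), (fun j => B j `&` B' j); split.
- exact: measurableI.
- by move=> j; exact: measurableI.
- apply/seteqP; split=> [w [[Aw Bw] [Aw' Bw']]|w [[Aw Aw'] Bw]].
    by split=> // j jk; split; [exact: Bw|exact: Bw'].
  by split; split=> // j /Bw[].
Qed.

Lemma historyT k : history k setT.
Proof.
exists setT, (fun=> setT); split=> //.
by rewrite /history_event preimage_setT bigcapT// setIT.
Qed.

Lemma historyS k : history k `<=` history k.+1.
Proof.
move=> _ [A [B [mA mB ->]]].
exists A, (fun j => if (j < k)%N then B j else setT); split => //.
  by move=> j; case: ifP.
rewrite /history_event; congr (_ `&` _); apply/seteqP; split=> w Bw j /= jk.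
  by case: ifPn => // jk'; exact: Bw.
by have := Bw j (ltnW jk); rewrite jk.
Qed.

Lemma history_X0 k A : measurable A -> history k (X0 @^-1` A).
Proof.
move=> mA; exists A, (fun=> setT); split=> //.
by rewrite /history_event bigcapT ?setIT.
Qed.

Lemma history_noise k B : measurable B -> history k.+1 (xis k @^-1` B).
Proof.
move=> mB; exists setT, (fun j => if j == k then B else setT); split=> //.
  by move=> j; case: ifP.
rewrite /history_event preimage_setT setTI; apply/seteqP; split=> w /=.
  by move=> Bw j _ /=; case: eqP => // ->.
by move=> /(_ k (ltnSn k)); rewrite eqxx.
Qed.

Lemma rfi_history k A : measurable A -> <<s history k >> (rfi T X0 xis k @^-1` A).
Proof.
elim: k A => [|k IH] A mA; first by apply: sub_sigma_algebra; exact: history_X0.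
have mpair : measurable_fun [set: g_sigma_algebraType (history k.+1)]
    (fun w => (rfi T X0 xis k w, xis k w)).
  apply: measurable_fun_pair => _ B mB; rewrite setTI.
    by apply: (sub_sigma_algebra2 (@historyS k)); exact: IH.
  by apply: sub_sigma_algebra; exact: history_noise.
have mT := measurableT_comp T_meas mpair.
by have := mT measurableT A mA; rewrite setTI.
Qed.

Lemma sigma_history_measurable k : <<s history k >> `<=` measurable.
Proof.
apply: smallest_sub; [exact: sigma_algebra_measurable|exact: history_measurable].
Qed.

Lemma measurable_rfi k : measurable_fun setT (rfi T X0 xis k).
Proof.
move=> _ A mA; rewrite setTI; apply: (@sigma_history_measurable k).
exact: rfi_history.
Qed.

(** Mutual independence is applied twice, to all the indices up to [k] and to
    all of them but the last: the two products differ by the factor of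
    [xis k]. *)
Lemma history_noise_indep k C B : history k C -> measurable B ->
  P (C `&` xis k @^-1` B) = P C * P (xis k @^-1` B).
Proof.
move=> [A [B' [mA mB' ->]]] mB.
pose J := [fset o in {: option 'I_k.+1}]%fset.
have JT o : o \in J by rewrite !inE.
pose V (o : option 'I_k.+1) := if o is Some j
  then xis j @^-1` (if (j < k)%N then B' j else B) else X0 @^-1` A.
pose o0 : option 'I_k.+1 := Some ord_max.
have mV (o : option 'I_k.+1) : (if o is Some j then g_sigma_algebra_preimage (xis j)
    else g_sigma_algebra_preimage X0) (V o).
  case: o => [j|] /=.
    by exists (if (j < k)%N then B' j else B); [case: ifP|rewrite setTI].
  by exists A => //; rewrite setTI.
have VJ : history_event k A B' `&` xis k @^-1` B = \bigcap_(o in [set` J]) V o.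
  apply/seteqP; split=> [w [[Aw Bw] Bkw] [j|] _ /=|w Vw] //=.
    case: ifPn => [|jk]; first exact: Bw.
    suff -> : nat_of_ord j = k by [].
    by apply/eqP; rewrite eqn_leq -ltnS ltn_ord/= leqNgt.
  split; last first.
    by have := Vw (Some ord_max) (JT _); rewrite /= ltnn.
  split; first exact: (Vw None (JT _)).
  move=> j /= jk; have := Vw (Some (widen_ord (leqnSn k) (Ordinal jk))) (JT _).
  by rewrite /= jk.
have VJ0 : history_event k A B' = \bigcap_(o in [set` (J `\ o0)%fset]) V o.
  apply/seteqP; split=> [w [Aw Bw] [j|] //= jJ|w Vw].
    have jk : (j < k)%N.
      rewrite ltn_neqAle -ltnS ltn_ord andbT; apply: contraTneq jJ => jk.
      rewrite in_fsetD1 negb_and negbK; apply/orP; left.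
      by apply/eqP; congr Some; exact/val_inj.
    by rewrite jk; exact: Bw.
  split; first by apply: (Vw None); rewrite /= in_fsetD1 JT.
  move=> j /= jk; have := Vw (Some (widen_ord (leqnSn k) (Ordinal jk))).
  rewrite /= jk; apply; rewrite in_fsetD1 JT andbT; apply/eqP => -[jk'].
  by rewrite jk' ltnn in jk.
have Vo0 : V o0 = xis k @^-1` B by rewrite /V /o0 ltnn.
have indep (J' : {fset option 'I_k.+1}) :
    P (\bigcap_(o in [set` J']) V o) = \prod_(o <- J') P (V o).
  by apply: (X0_indep (k := k)) => o _; exact: mV.
rewrite VJ VJ0 -Vo0 !indep.
by rewrite (big_fsetD1 o0) ?JT//= muleC.
Qed.

(** The restriction of [P] to [xis k @^-1` B] and the multiple of [P] by the
    probability of that event agree on the pi-system [history k]. *)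
Lemma rfi_noise_indep k C B : <<s history k >> C -> measurable B ->
  P (C `&` xis k @^-1` B) = P C * P (xis k @^-1` B).
Proof.
move=> hC mB; have mQ : measurable (xis k @^-1` B) by exact: measurable_funPTI.
have Q0 : (0 <= fine (P (xis k @^-1` B)))%R by rewrite fine_ge0.
have PQ : (fine (P (xis k @^-1` B)))%:E = P (xis k @^-1` B).
  by rewrite fineK// fin_num_measure.
pose m1 : {measure set Omega -> \bar R} := mrestr P mQ.
pose m2 : {measure set Omega -> \bar R} := mscale (NngNum Q0) P.
have m2E D : m2 D = P D * P (xis k @^-1` B).
  by rewrite muleC -PQ.
rewrite -m2E -[LHS]/(m1 C).
apply: (g_sigma_algebra_measure_unique (history k) _ (fun=> setT)) hC => //.
- exact: history_measurable.
- by move=> _; exact: historyT.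
- by apply: bigcup_const; exists 0%N.
- exact: history_setI.
- by move=> D hD; rewrite m2E -[LHS]/(P (D `&` _)) history_noise_indep.
- move=> _; rewrite -[m1 _]/(P (_ `&` _)) -ge0_fin_numE//.
  by rewrite fin_num_measure// setTI.
Qed.

Variable xi : {RV P >-> I}.
Hypothesis xis_xi : forall k,
  measure_eq (distribution P (xis k)) (distribution P xi).

Definition rfi_RV k : {mfun Omega >-> S} := HB.pack (rfi T X0 xis k)
  (isMeasurableFun.Build _ _ _ _ (rfi T X0 xis k) (measurable_rfi k)).

Definition chain_distribution k : probability S R := distribution P (rfi_RV k).

(** The pair of the [k]-th iterate and [xis k] has the product law, and the
    transition kernel integrates out the second factor. *)
Lemma chain_distributionS k A : measurable A ->
  chain_distribution k.+1 A =
  markov_operator (transition_kernel T xi) (chain_distribution k) A.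
Proof.
move=> mA.
have mpair : measurable_fun setT (fun w => (rfi T X0 xis k w, xis k w)).
  by apply: measurable_fun_pair => //; exact: measurable_rfi.
pose XN : {mfun Omega >-> (S * I)%type} := HB.pack
  (fun w => (rfi T X0 xis k w, xis k w)) (isMeasurableFun.Build _ _ _ _ _ mpair).
have mTA : measurable ((fun z : S * I => T z.2 z.1) @^-1` A).
  by rewrite -[X in measurable X]setTI; exact: T_meas.
transitivity (((chain_distribution k) \x (distribution P xi))
    ((fun z : S * I => T z.2 z.1) @^-1` A)).
  suff -> : ((chain_distribution k) \x (distribution P xi))
    ((fun z : S * I => T z.2 z.1) @^-1` A) =
    distribution P XN ((fun z : S * I => T z.2 z.1) @^-1` A) by [].
  apply: (@product_measure_unique _ _ _ _ R _ _ (distribution P XN)) => //.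
  move=> A' B mA' mB.
  rewrite [RHS](_ : _ = chain_distribution k A' * distribution P (xis k) B).
    by apply: rfi_noise_indep => //; exact: rfi_history.
  by congr (_ * _); apply/esym; exact: xis_xi.
apply: eq_integral => x _; congr (P _); apply/seteqP.
by split=> w; rewrite /xsection/= inE.
Qed.

End chain_law.
(** * Compactness of balls in finite dimension *)

Section finite_dimensional_balls.
Import VectorInternalTheory.
Context {R : realType} {E : euclideanType R}.
Let n := dim E.
Let phi : 'rV[R]_n -> E := r2v.

Let phi_continuous : continuous phi.
Proof.
have -> : phi = fun u => \sum_i u ord0 i *: phi (delta_mx 0 i).
  apply/funext => u; rewrite [in LHS](row_sum_delta u) /phi linear_sum.
  by apply: eq_bigr => i _; rewrite linearZ.
apply: continuous_big => [|i _ u].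
  exact: add_continuous.
by apply: cvgZr_tmp; [exact: nbhs_filter|exact: coord_continuous].
Qed.

(** Coordinates identify [E] with a space of row vectors by a linear continuous
    bijection [phi]. On the compact unit sphere of coordinates the norm of [phi u]
    stays away from 0, so that the norm of [u] is at most that of [phi u] divided
    by a constant [c]: a ball of [E] is a closed part of the image of a compact
    ball of coordinates. *)
Lemma compact_norm_le (r : R) : compact [set x : E | `|x| <= r].
Proof.
pose sph := [set u : 'rV[R]_n | `|u| = 1].
have csph : compact sph.
  apply: bounded_closed_compact.
    by exists 1; split=> // M M1 u /= ->; exact: ltW.
  rewrite (_ : sph = Num.norm @^-1` [set 1])//.
  apply: preimage_closed; last exact: closed_eq.
  by move=> ? _; exact: norm_continuous.
have cK : compact ((fun u => `|phi u|) @` sph).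
  apply: continuous_compact => //; apply: continuous_subspaceT => u.
  by apply: continuous_comp; [exact: phi_continuous|exact: norm_continuous].
have n0 : (~` ((fun u => `|phi u|) @` sph)) 0.
  move=> [u /= u1 /normr0_eq0 pu]; suff u0 : u = 0.
    by have /eqP := oner_neq0 R; rewrite -u1 u0; apply; exact: normr0.
  by apply: (@r2v_inj _ E); rewrite linear0; exact: pu.
have /nbhs_ballP[c /= c0 cS] : nbhs (0:R) (~` ((fun u => `|phi u|) @` sph)).
  apply: open_nbhs_nbhs; split => //; apply: closed_openC.
  by apply: compact_closed => //; exact: norm_hausdorff.
(* Homogeneity extends the bound from the unit sphere. *)
have phi_ge u : c * `|u| <= `|phi u|.
  have [->|u0] := eqVneq u 0; first by rewrite normr0 mulr0.
  have nu0 : 0 < `|u| by rewrite normr_gt0.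
  have su : sph (`|u|^-1 *: u).
    by rewrite /sph/= normrZ normfV normr_id mulVf// gt_eqF.
  rewrite -ler_pdivlMr// leNgt; apply/negP => uc.
  apply: (cS (`|phi (`|u|^-1 *: u)|)); last by exists (`|u|^-1 *: u).
  rewrite /ball/= sub0r normrN normr_id /phi linearZ normrZ normfV normr_id.
  by rewrite mulrC.
have cB : compact (phi @` [set u | `|u| <= r / c]).
  apply: continuous_compact; first exact: continuous_subspaceT.
  apply: bounded_closed_compact.
    exists (r / c); split; first exact: num_real.
    by move=> M M1 u /= ur; exact: le_trans ur (ltW M1).
  rewrite (_ : [set u | _] = Num.norm @^-1` [set x | x <= r / c])//.
  by apply: preimage_closed; [move=> ? _; exact: norm_continuous|exact: closed_le].
apply: subclosed_compact cB _.
  rewrite (_ : [set x | _] = Num.norm @^-1` [set x | x <= r])//.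
  by apply: preimage_closed; [move=> ? _; exact: norm_continuous|exact: closed_le].
move=> x /= xr; exists (v2r x); last exact: v2rK.
by rewrite /= ler_pdivlMr// mulrC (le_trans (phi_ge _))// /phi v2rK.
Qed.

End finite_dimensional_balls.

(** * Comparison of Borel probabilities on open sets *)

Section weak_limit_invariance.
Context {R : realType} {E : normedModType R}.

Lemma erosion_interior (r : R) (G : set E) : 0 < r ->
  erosion r G `<=` (erosion (r / 2) G)°.
Proof.
move=> r0 x xG; apply/nbhs_ballP; exists (r / 2); first by rewrite /= divr_gt0.
by move=> y xy z yz; apply: xG; rewrite (splitr r); exact: ball_triangle yz.
Qed.

Lemma bigcup_erosion (G : set E) : open G ->
  \bigcup_n erosion n.+1%:R^-1 G = G.
Proof.
move=> oG; apply/seteqP; split=> x.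
  by move=> [n _]; apply: erosion_sub; rewrite invr_gt0.
move=> Gx; have [[A B] /= [Ax [N _ BN]] ABG] := near_erosion oG Gx.
exists N => //; apply: (ABG (x, N)); split => /=; first exact: nbhs_singleton.
exact: (BN N (leqnn N)).
Qed.

(** Continuity from below along the erosions of [G]. *)
Lemma probability_open_le (m : probability (borel E) R) (G : set E) (c : \bar R) :
  open G -> (forall n, m (erosion n.+1%:R^-1 G) <= c)%E -> (m G <= c)%E.
Proof.
move=> oG mc; have mer n : measurable (erosion n.+1%:R^-1 G : set (borel E)).
  exact: measurable_erosion.
have nd : nondecreasing_seq (fun n => erosion n.+1%:R^-1 G).
  move=> i j ij; apply/subsetPset; apply: le_erosion.
  by rewrite lef_pV2 ?posrE// ler_nat.
have cv := nondecreasing_cvg_mu (mu := m) mer (bigcupT_measurable _ mer) nd.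
rewrite -{1}(bigcup_erosion oG) -(cvg_lim _ cv)//.
apply: lime_le; first by apply/cvg_ex; eexists; exact: cv.
exact: nearW.
Qed.

Lemma eq_probability_open (m1 m2 : probability (borel E) R) :
  (forall G : set E, open G -> m1 G = m2 G) ->
  forall A, measurable A -> m1 A = m2 A.
Proof.
move=> m12 A mA.
apply: (@measure_unique _ R (borel E) (@open E) (fun=> setT) _ _ _ _ m1 m2) => //.
- by move=> B C oB oC; exact: openI.
- by move=> _; exact: openT.
- by apply: bigcup_const; exists 0%N.
- by move=> _; rewrite -ge0_fin_numE// fin_num_measure.
Qed.

(** Passing to complements reverses the inequality on closed sets, in particular
    on the erosions of an open set, which approximate it from inside. *)
Lemma eq_probability_le_open (m1 m2 : probability (borel E) R) :
  (forall G : set E, open G -> m1 G <= m2 G)%E ->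
  forall A, measurable A -> m1 A = m2 A.
Proof.
move=> m12; apply: eq_probability_open => G oG.
apply/eqP; rewrite eq_le m12//=; apply: probability_open_le => // n.
have mer : measurable (erosion n.+1%:R^-1 G : set (borel E)).
  exact: measurable_erosion.
have mG : measurable (G : set (borel E)) by exact: sub_sigma_algebra.
apply: (@le_trans _ _ (m1 (erosion n.+1%:R^-1 G))).
  have oC := closed_openC (@closed_erosion R E n.+1%:R^-1 G).
  have := probability_setC m1 (measurableC mer).
  have := probability_setC m2 (measurableC mer).
  by rewrite setCK => -> ->; apply: leeD2l; rewrite leeN2; exact: m12.
rewrite le_measure ?inE//.
by apply: erosion_sub; rewrite invr_gt0.
Qed.

End weak_limit_invariance.

(** * Invariant measures from tight orbits *)

Section mean_content.
Context {R : realType} {E : normedModType R}.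
Variables (L : (nat -> R) -> R) (a : nat -> probability (borel E) R).
Hypothesis HL : banach_limit L.

Definition mean_content (A : set E) : R := L (fun k => fine (a k A)).

Lemma bounded_seq_probability (A : set (borel E)) : measurable A ->
  bounded_seq (fun k => fine (a k A)).
Proof.
move=> mA; exists 1 => k; have /andP[m0 m1] := fine_probability_bound (a k) mA.
by rewrite ger0_norm.
Qed.

Lemma tight_mean_content :
  (forall e, 0 < e -> exists2 K : set E, compact K &
     forall k, (a k (~` K) <= e%:E)%E) ->
  tight_content mean_content.
Proof.
move=> tight_a.
have bcst c : bounded_seq (fun=> c : R) by exists `|c|.
split.
- move=> A mA; rewrite -(blim_cst HL 0); apply: (blim_le HL) => //.
    exact: bounded_seq_probability.
  by move=> k; have /andP[] := fine_probability_bound (a k) mA.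
- move=> A B mA mB AB; rewrite -(blimD HL); [|exact: bounded_seq_probability..].
  congr L; apply/funext => k; rewrite measureU// fineD//; exact: fin_num_measure.
- rewrite -[RHS](blim_cst HL 1); congr L; apply/funext => k.
  by rewrite probability_setT.
- move=> e e0; have [K cK aK] := tight_a e e0; exists K => //.
  have mK : measurable (~` K : set (borel E)).
    apply: sub_sigma_algebra; apply: closed_openC.
    exact: (compact_closed (@norm_hausdorff _ E)).
  rewrite -(blim_cst HL e); apply: (blim_le HL) => //.
    exact: bounded_seq_probability.
  by move=> k; rewrite -lee_fin fineK// fin_num_measure.
Qed.

End mean_content.

Lemma markov_inequality_norm (R : realType) (E : normedModType R) d
    (Omega : measurableType d) (P : probability Omega R)
    (X : {RV P >-> borel E}) (M r : R) : 0 < r ->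
  ('E_P[fun w => `|X w : E|%R] <= M%:E)%E ->
  (P [set w | r < `|X w : E|]%R <= (M / r)%:E)%E.
Proof.
move=> r0 EX.
have mN : measurable_fun setT (fun x : borel E => `|x : E|).
  apply: (measurability _ (RGenOpens.measurableE R)) => _ [_ [b [c ->]] <-].
  rewrite setTI; apply: sub_sigma_algebra.
  by have /continuousP := @norm_continuous R E; apply; exact: interval_open.
have mNX : measurable_fun setT (fun w => `|X w : E|).
  exact: (measurableT_comp mN).
pose NX : {RV P >-> R} := HB.pack (fun w => `|X w : E|)
  (isMeasurableFun.Build _ _ _ _ _ mNX).
have mk : (r%:E * P [set w | r%:E <= `|(NX w)%:E|] <= M%:E)%E.
  apply: le_trans EX; rewrite (_ : (fun w => `|X w : E|) = (id \o Num.norm) \o NX).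
    by apply: (@markov _ _ _ _ NX id r) => //.
  by apply/funext => w /=; rewrite normr_id.
rewrite mulrC EFinM lee_pdivlMl//; apply: le_trans mk.
rewrite lee_pmul2l// le_measure ?inE//.
- rewrite (_ : [set w | _] = (fun w => `|X w : E|) @^-1` `]r, +oo[).
    by rewrite -[X in measurable X]setTI; by apply: (mNX measurableT).
  by apply/seteqP; split=> w /=; rewrite in_itv/= andbT.
- rewrite -[X in measurable X]setTI; apply: measurable_lee => //.
  by apply/measurable_EFinP; exact: measurableT_comp.
- by move=> w /= /ltW rX; rewrite lee_fin normr_id.
Qed.

Section invariant_measure_existence.
Context {R : realType} {E : normedModType R}.
Context (dI : measure_display) (I : measurableType dI).
Context (dO : measure_display) (Omega : measurableType dO).
Variables (P : probability Omega R) (T : I -> E -> E) (xi : {RV P >-> I}).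
Hypothesis T_meas : measurable_fun [set: borel E * I]
  (fun z : borel E * I => T z.2 z.1 : borel E).
Hypothesis T_cont : forall i, continuous (T i).

Let p := transition_kernel (T : I -> borel E -> borel E) xi.

(** The Krylov-Bogolyubov theorem for orbits of the Markov operator on
    measures. *)
Lemma tight_orbit_invariant_measure (a : nat -> probability (borel E) R) :
  (forall k A, measurable A -> a k.+1 A = markov_operator p (a k) A) ->
  (forall e, 0 < e -> exists2 K : set E, compact K &
     forall k, (a k (~` K) <= e%:E)%E) ->
  exists pi : probability (borel E) R, invariant_measure p pi.
Proof.
move=> aS tight_a; have [L HL] := @ex_banach_limit R.
pose lam := mean_content L a.
have tlam : tight_content lam by exact: tight_mean_content.
have [pi piE] := ex_limit_measure tlam.
have [q qE] := ex_markov_step xi T_meas pi.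
(* Semicontinuity of the kernel and invariance of the Banach limit. *)
have q_le_lam (G : set E) : open G -> (q G <= (lam G)%:E)%E.
  move=> oG; have mG : measurable (G : set (borel E)) by exact: sub_sigma_algebra.
  pose f (x : borel E) := fine (p x G).
  have pf x : p x G = (f x)%:E by rewrite fineK// transition_kernel_fin_num.
  have mf : measurable_fun setT f.
    by apply: measurableT_comp => //; exact: measurable_transition_kernel.
  have moE (m : probability (borel E) R) :
      (\int[m]_x (f x)%:E)%E = markov_operator p m G.
    by apply: eq_integral => x _; rewrite pf.
  have f0 x : 0 <= f x by rewrite fine_ge0// transition_kernel_ge0.
  have f1 x : f x <= 1 by rewrite -lee_fin -pf; exact: transition_kernel_le1.
  have := @integral_le_blim _ _ R f mf f0 f1 L a pi HL.
  rewrite moE -qE// => qL.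
  rewrite -(fineK (fin_num_measure q _ mG)) lee_fin.
  apply: le_trans (qL _) _.
    move=> t; have oft : open [set x : E | t < f x] by exact: transition_kernel_lsc.
    rewrite piE//; apply: (inner_content_le tlam); first exact: sub_sigma_algebra.
    by move=> n; apply: erosion_sub; rewrite invr_gt0.
  rewrite /lam /mean_content -[leRHS](blim_shift HL).
    rewrite le_eqVlt; apply/orP; left; apply/eqP; congr L.
    by apply/funext => k; rewrite moE aS.
  exact: bounded_seq_probability.
exists pi => A mA; rewrite -qE//.
apply: eq_probability_le_open mA => G oG.
apply: probability_open_le => // n.
have n0 : 0 < n.+1%:R^-1 :> R by rewrite invr_gt0.
(* An open set fits between the erosions by r and by r / 2, and for
   r = 1 / (n + 1) the latter is the erosion of rank 2 n + 1. *)
have n2 : n.+1%:R^-1 / 2 = (n.*2.+1).+1%:R^-1 :> R.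
  by rewrite -doubleS -muln2 natrM invfM.
have oV : open (erosion (n.*2.+1).+1%:R^-1 G)° by exact: open_interior.
have eV := erosion_interior n0 (G := G); rewrite n2 in eV.
apply: (@le_trans _ _ (q (erosion (n.*2.+1).+1%:R^-1 G)°)).
  rewrite le_measure ?inE//; [exact: measurable_erosion|exact: sub_sigma_algebra].
apply: (le_trans (q_le_lam _ oV)); rewrite piE//.
apply: le_trans (inner_content_ge lam n.*2.+1 G); rewrite lee_fin.
apply: (le_tcontent tlam); [exact: sub_sigma_algebra|exact: measurable_erosion|].
exact: interior_subset.
Qed.

End invariant_measure_existence.

Theorem proposition3p3 (R : realType) (E : euclideanType R)
    (dI : measure_display) (I : measurableType dI)
    (dO : measure_display) (Omega : measurableType dO)
    (P : probability Omega R)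
    (T : I -> E -> E)
    (T_meas : measurable_fun [set: borel E * I]
                (fun z : borel E * I => T z.2 z.1 : borel E))
    (T_cont : forall i : I, continuous (T i))
    (xi : {RV P >-> I}) (xis : nat -> {RV P >-> I})
    (xis_iid : iid_as xi xis)
    (mu : probability (borel E) R)
    (X0 : {RV P >-> borel E})
    (X0_mu : measure_eq (distribution P X0) mu)
    (X0_indep : forall k : nat, independent_upto X0 xis k)
    (M : R) (M_ge0 : 0 <= M)
    (EX_le : forall k : nat,
       ('E_P[fun w => `|rfi T X0 xis k w : E|%R] <= M%:E)%E) :
  exists pi : probability (borel E) R,
    invariant_measure (transition_kernel (T : I -> borel E -> borel E) xi) pi.

Proof.
have [xis_xi _] := xis_iid.
pose a := chain_distribution (P := P) T_meas X0 xis.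
apply: (@tight_orbit_invariant_measure _ _ _ _ _ _ P T xi T_meas T_cont a).
  by move=> k A mA; exact: chain_distributionS.
(* M + 1 rather than M keeps the radius positive when M = 0. *)
move=> e e0; pose r := (M + 1) / e.
have M1 : 0 < M + 1 by rewrite ltr_wpDl.
have r0 : 0 < r by rewrite divr_gt0.
exists [set x : E | `|x| <= r]; first exact: compact_norm_le.
move=> k; apply: (@le_trans _ _ (M / r)%:E).
  apply: le_trans (@markov_inequality_norm R E _ _ P (rfi_RV T_meas X0 xis k)
    M r r0 (EX_le k)).
  rewrite le_eqVlt; apply/orP; left; apply/eqP; congr (P _).
  by apply/seteqP; split=> w /=; rewrite ltNge => /negP.
rewrite lee_fin /r invf_div mulrCA ger_pMr// ler_pdivrMr// mul1r.
by rewrite lerDl.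
Qed.
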